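(* Let $C$ be a collage system of size $c$ (i.e., with $c$ rules) generating a string $T$. Then $T$ has a string attractor of size at most $c$.
   Context: A string attractor of a string $T$ of length $n$ is a set $\Gamma\subseteq\{1,\dots,n\}$ of positions such that every substring $T[i..j]$ has an occurrence $T[i'..j']=T[i..j]$ with $p\in[i',j']$ for some $p\in\Gamma$. A collage system is a finite set of rules, each defining a distinct nonterminal, of four types: $X\rightarrow a$ ($a$ a terminal character); $X\rightarrow AB$ with $A,B$ nonterminals different from $X$; $X\rightarrow R^{\ell}$ with $R\neq X$ a nonterminal and $\ell\ge 2$ (expansion of $X$ is the expansion of $R$ repeated $\ell$ times); $X\rightarrow K[l..r]$ with $K\neq X$ (expansion of $X$ is the substring from position $l$ to $r$ of the expansion of $K$). The system is acyclic: the derivation tree of any nonterminal $X$ contains neither $X$ nor any $X[l..r]$ as an internal node. The generated string is the expansion of a designated starting nonterminal $S$. *)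

(* Defs.v *)
From mathcomp Require Import all_boot.
From Stdlib Require Import Relation_Operators.

Set Implicit Arguments.
Unset Strict Implicit.
Unset Printing Implicit Defensive.

(* Positions in strings are numbered from 1, and T[i..j] includes both ends. *)
Definition substr (Sigma : Type) (T : seq Sigma) (i j : nat) : seq Sigma :=
  take (j.+1 - i) (drop i.-1 T).

(* The ordinal p : 'I_(size T) stands for the position p.+1 of T. *)
Definition string_attractor (Sigma : Type) (T : seq Sigma)
    (Gamma : {set 'I_(size T)}) : Prop :=
  forall i j : nat, 1 <= i -> i <= j -> j <= size T ->
  exists i' j' : nat,
    [/\ 1 <= i', i' <= j', j' <= size T, substr T i' j' = substr T i j
      & exists2 p : 'I_(size T), p \in Gamma & i' <= p.+1 <= j'].

Inductive rule (Sigma : Type) (V : finType) : Type :=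
| Term of Sigma
| Pair of V & V
| Power of V & nat
| Trunc of V & nat & nat.

Arguments Term {Sigma V} a.
Arguments Pair {Sigma V} A B.
Arguments Power {Sigma V} R l.
Arguments Trunc {Sigma V} K l r.

(* Every nonterminal has exactly one rule, so a set of rules is a function on
   the finite type V of nonterminals. *)
Record rule_system (Sigma : Type) (V : finType) : Type := RuleSystem {
  rule_of : V -> rule Sigma V;
  start : V
}.

Definition system_size (Sigma : Type) (V : finType)
    (C : rule_system Sigma V) : nat := #|V|.

Definition well_formed (Sigma : Type) (V : finType)
    (C : rule_system Sigma V) : Prop :=
  forall X : V, match rule_of C X with
  | Term _ => True
  | Pair A B => A <> X /\ B <> X
  | Power R l => R <> X /\ 2 <= l
  | Trunc K _ _ => K <> X
  end.

(* E X is the expansion of X.  The bounds in the last case say that K[l..r]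
   denotes an actual substring of the expansion of K. *)
Definition is_expansion (Sigma : Type) (V : finType)
    (C : rule_system Sigma V) (E : V -> seq Sigma) : Prop :=
  forall X : V, match rule_of C X with
  | Term a => E X = [:: a]
  | Pair A B => E X = E A ++ E B
  | Power R l => E X = flatten (nseq l (E R))
  | Trunc K l r =>
      [/\ 1 <= l, l <= r, r <= size (E K) & E X = substr (E K) l r]
  end.

(* Internal nodes of derivation trees, labelled X or X[l..r]. *)
Inductive node (V : Type) : Type :=
| Whole of V
| Part of V & nat & nat.

Arguments Whole {V} X.
Arguments Part {V} X l r.

Definition node_nonterminal (V : Type) (u : node V) : V :=
  match u with Whole X => X | Part X _ _ => X end.

(* [child C len u v]: v labels an internal node that is a child of a node
   labelled u, where len X is the length of the expansion of X.  A truncation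
   X[l..r] is pushed down to the children of X whose expansion meets [l..r];
   those outside [l..r] are not part of the tree.  A child covered completely
   by a truncation is labelled A[1..len A] rather than A. *)
Inductive child (Sigma : Type) (V : finType) (C : rule_system Sigma V)
    (len : V -> nat) : node V -> node V -> Prop :=
| child_pair_l X A B : rule_of C X = Pair A B ->
    child C len (Whole X) (Whole A)
| child_pair_r X A B : rule_of C X = Pair A B ->
    child C len (Whole X) (Whole B)
| child_power X R k : rule_of C X = Power R k ->
    child C len (Whole X) (Whole R)
| child_trunc X K l r : rule_of C X = Trunc K l r ->
    child C len (Whole X) (Part K l r)
| child_part_pair_l X A B l r : rule_of C X = Pair A B ->
    l <= len A ->
    child C len (Part X l r) (Part A l (minn r (len A)))
| child_part_pair_r X A B l r : rule_of C X = Pair A B ->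
    len A < r ->
    child C len (Part X l r)
      (Part B (maxn l (len A).+1 - len A) (r - len A))
| child_part_power X R k l r i : rule_of C X = Power R k ->
    i < k -> i * len R < r -> l <= i.+1 * len R ->
    child C len (Part X l r)
      (Part R (maxn l (i * len R).+1 - i * len R)
              (minn r (i.+1 * len R) - i * len R))
| child_part_trunc X K l' r' l r : rule_of C X = Trunc K l' r' ->
    child C len (Part X l r) (Part K (l' + l - 1) (l' + r - 1)).

(* The proper internal nodes of the derivation tree of X are the strict
   descendants of its root [Whole X]. *)
Definition acyclic (Sigma : Type) (V : finType) (C : rule_system Sigma V)
    (len : V -> nat) : Prop :=
  forall (X : V) (u : node V),
    clos_trans (node V) (child C len) (Whole X) u -> node_nonterminal u <> X.

(* Expansions exist and are unique for acyclic rules with valid truncation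
   bounds, so the expansion map is fixed here by its defining equations. *)
Definition collage_system_generating (Sigma : Type) (V : finType)
    (C : rule_system Sigma V) (T : seq Sigma) : Prop :=
  exists E : V -> seq Sigma,
    [/\ well_formed C, is_expansion C E, acyclic C (fun X => size (E X))
      & E (start C) = T].

(* Main.v *)
Require Import Defs.
From mathcomp Require Import all_boot zify.
From Stdlib Require Import Relation_Operators.

(* The derivation tree of T consists of nodes X[l..r], each of which occurs in
   T.  Keep, for every nonterminal X, only the inclusion-maximal intervals
   [l..r].  If X -> AB, put a position at the boundary of A and B in one
   occurrence of every maximal X[l..r] that crosses this boundary.  A substring
   of T then moves down the tree until it crosses a boundary (or reaches a
   terminal) inside some maximal node, which happens by acyclicity.

   To count the positions, look at the maximal nodes that are truncated on the
   left (l > 1).  Each of them has a maximal parent, which has no other child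
   truncated on the left and, if its rule is X -> AB, is itself truncated on
   the left.  Of all maximal nodes crossing the boundary of X, only the one
   with the least l can be such a parent, because its left child contains the
   left children of the others.  Hence the positions in excess of one per
   nonterminal inject into the maximal nodes X[1..r] with a truncation rule for
   X, of which there is at most one per X.  A power X -> R^k is treated as
   X -> R X', where X' is a prefix of X. *)

Set Implicit Arguments.
Unset Strict Implicit.
Unset Printing Implicit Defensive.

(** * Factors of strings, as half-open intervals counted from 0 *)

Definition factor (S : Type) (s : seq S) (a b : nat) : seq S :=
  take (b - a) (drop a s).

Lemma size_factor (S : Type) (s : seq S) (a b : nat) :
  b <= size s -> size (factor s a b) = b - a.
Proof. by move=> h; rewrite /factor size_take_min size_drop; lia. Qed.

Lemma take_drop_take_drop (S : Type) (s : seq S) (m k n o : nat) :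
  k + m <= n -> take m (drop k (take n (drop o s))) = take m (drop (o + k) s).
Proof.
move=> h; rewrite [drop k (take _ _)](_ : _ = take (n - k) (drop k (drop o s))).
  by rewrite take_takel ?drop_drop ?(addnC k); last lia.
by rewrite [RHS]take_drop subnK; last lia.
Qed.

Lemma factor_factor (S : Type) (s : seq S) (a b x y : nat) :
  y <= b - a -> factor (factor s a b) x y = factor s (a + x) (a + y).
Proof.
move=> h; rewrite /factor subnDl.
have [/take_drop_take_drop -> //|hk] := leqP (x + (y - x)) (b - a).
by rewrite (_ : y - x = 0) ?take0 //; lia.
Qed.

Lemma factor_catl (S : Type) (s t : seq S) (x y : nat) :
  y <= size s -> factor (s ++ t) x y = factor s x y.
Proof.
move=> h; have [hxy|hxy] := leqP y x.
  by rewrite /factor (_ : y - x = 0) ?take0 //; lia.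
rewrite /factor drop_cat (_ : x < size s); last lia.
by rewrite takel_cat // size_drop; lia.
Qed.

Lemma factor_catr (S : Type) (s t : seq S) (x y : nat) :
  size s <= x -> factor (s ++ t) x y = factor t (x - size s) (y - size s).
Proof.
move=> h; rewrite /factor drop_cat ltnNge h /=.
by rewrite (_ : y - size s - (x - size s) = y - x) //; lia.
Qed.

Lemma flatten_nseqSr (S : Type) (s : seq S) (k : nat) :
  flatten (nseq k.+1 s) = flatten (nseq k s) ++ s.
Proof.
elim: k => [|k IH]; first by rewrite /= cats0.
by move: (congr1 (cat s) IH); rewrite catA.
Qed.

Lemma size_flatten_nseq (S : Type) (s : seq S) (k : nat) :
  size (flatten (nseq k s)) = k * size s.
Proof. by elim: k => //= k IH; rewrite size_cat IH; lia. Qed.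

(** Of the elements of [A] above [d], one of largest weight is maximal, since [w] grows strictly
    along [le]. *)
Lemma exists_dominating_maximal (D : finType) (A : {set D}) (le : rel D)
    (w : D -> nat) (d : D) :
  reflexive le -> transitive le ->
  (forall x y, le x y -> w y <= w x -> y = x) ->
  d \in A ->
  exists2 m, m \in A /\ (forall y, y \in A -> le m y -> y = m) & le d m.
Proof.
move=> refl_le trans_le strict dA.
have dP : (d \in A) && le d d by rewrite dA refl_le.
case: (@arg_maxnP _ d (fun x => (x \in A) && le d x) w dP).
move=> m /andP[mA dm] mmax; exists m => //; split=> // y yA my.
by apply: (strict _ _ my); apply: mmax; rewrite yA (trans_le _ _ _ dm my).
Qed.

(** * Rules as leaves, splits and cuts *)

Section Collage.

Variables (Sigma : Type) (V : finType) (C : rule_system Sigma V).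
Variable E : V -> seq Sigma.
Hypothesis wfC : well_formed C.
Hypothesis expE : is_expansion C E.
Hypothesis acyC : acyclic C (fun X => size (E X)).

Local Notation len X := (size (E X)).

(* [Split A B] says that the expansion of X is that of A followed by a prefix
   of that of B.  A power R^k is R followed by a prefix of R^k itself, so it is
   encoded as a split whose second component is X. *)
Variant shape := Leaf | Split of V & V | Cut of V & nat.

Definition shape_of (X : V) : shape :=
  match rule_of C X with
  | Term _ => Leaf
  | Pair A B => Split A B
  | Power R _ => Split R X
  | Trunc K l _ => Cut K l.-1
  end.

Lemma leaf_len (X : V) : shape_of X = Leaf -> len X = 1.
Proof. by rewrite /shape_of; move: (expE X); case: rule_of => // a ->. Qed.

Lemma split_len (X A B : V) :
  shape_of X = Split A B -> len A <= len X <= len A + len B.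
Proof.
rewrite /shape_of; move: (expE X) (wfC X).
case: rule_of => // [A' B'|R k] eX; first by move=> _ [<- <-]; rewrite eX size_cat; lia.
by move=> [_ k2] [<- <-]; rewrite eX size_flatten_nseq; nia.
Qed.

Lemma split_factor_l (X A B : V) (x y : nat) :
  shape_of X = Split A B -> y <= len A ->
  factor (E X) x y = factor (E A) x y.
Proof.
rewrite /shape_of; move: (expE X) (wfC X).
case: rule_of => // [A' B'|R [|k]] eX; first by move=> _ [<- _] h; rewrite eX factor_catl.
  by case.
by move=> _ [<- _] h; rewrite eX /= factor_catl.
Qed.

Lemma split_factor_r (X A B : V) (x y : nat) :
  shape_of X = Split A B -> len A <= x -> y <= len X ->
  factor (E X) x y = factor (E B) (x - len A) (y - len A).
Proof.
rewrite /shape_of; move: (expE X) (wfC X).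
case: rule_of => // [A' B'|R [|k]] eX.
- by move=> _ [<- <-] h _; rewrite eX factor_catr.
- by case.
move=> _ [<- <-] hx hy; have := hy; rewrite {1}eX size_flatten_nseq => hy'.
(* The left side loses its first copy of [E R], the right side its last one; the same power remains
   on both sides. *)
rewrite {1}eX /= factor_catr // eX flatten_nseqSr factor_catl //.
by rewrite size_flatten_nseq; nia.
Qed.

Lemma cut_len (X K : V) (s : nat) :
  shape_of X = Cut K s -> s + len X <= len K.
Proof.
rewrite /shape_of; move: (expE X); case: rule_of => // K' l r [l1 lr rK eX] [<- <-].
by rewrite eX /substr size_take_min size_drop; lia.
Qed.

Lemma cut_factor (X K : V) (s x y : nat) :
  shape_of X = Cut K s -> y <= len X ->
  factor (E X) x y = factor (E K) (s + x) (s + y).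
Proof.
rewrite /shape_of; move: (expE X); case: rule_of => // K' l r [l1 lr rK eX] [<- <-].
have -> : E X = factor (E K') l.-1 r.
  by rewrite eX /substr /factor (_ : r.+1 - l = r - l.-1) //; lia.
by rewrite size_factor // => h; rewrite factor_factor.
Qed.

(** * Nodes as triples, and their kids *)

Local Notation triple := (V * nat * nat)%type.

(* The triple (X, a, b) is the node X[a+1..b]. *)
Definition valid (t : triple) : bool := t.1.2 < t.2 <= len t.1.1.

Definition below (t u : triple) : bool :=
  [&& t.1.1 == u.1.1, u.1.2 <= t.1.2 & t.2 <= u.2].

(** When the node crosses the boundary, truncated subtraction makes its right kid start at 0. For a
    power of [R], the right kid is again a node of [X], shifted by one copy of [R]. *)
Definition kids (t : triple) : seq triple :=
  let: (X, a, b) := t in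
  match shape_of X with
  | Leaf => [::]
  | Split A B =>
      (if a < len A then [:: (A, a, minn b (len A))] else [::]) ++
      (if len A < b then [:: (B, a - len A, b - len A)] else [::])
  | Cut K s => [:: (K, s + a, s + b)]
  end.

Variant kid_spec (X : V) (a b : nat) (u : triple) : Prop :=
| KidLeft A B of shape_of X = Split A B & a < len A
    & u = (A, a, minn b (len A))
| KidRight A B of shape_of X = Split A B & len A < b
    & u = (B, a - len A, b - len A)
| KidCut K s of shape_of X = Cut K s & u = (K, s + a, s + b).

Lemma kidsP (X : V) (a b : nat) (u : triple) :
  reflect (kid_spec X a b u) (u \in kids (X, a, b)).
Proof.
apply: (iffP idP) => /=.
  case h: shape_of => [|A B|K s] //; last by rewrite inE => /eqP; apply: KidCut.
  rewrite mem_cat => /orP[]; case: ifP => // hc; rewrite inE => /eqP.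
    exact: KidLeft h hc.
  exact: KidRight h hc.
case=> [A B -> h ->|A B -> h ->|K s -> ->]; last by rewrite inE.
  by rewrite h inE eqxx.
by rewrite h mem_cat inE eqxx orbT.
Qed.

Lemma kid_valid (t u : triple) : valid t -> u \in kids t -> valid u.
Proof.
case: t => [[X a] b]; rewrite /valid /= => /andP[ab bX] /kidsP[A B h ha ->|A B h hb ->|K s h ->] /=.
- by lia.
- by have := split_len h; lia.
by have := cut_len h; lia.
Qed.

(** Clipping at the boundary is monotone in the interval. This is what later gives maximal demands
    maximal parents. *)
Lemma kid_mono (t t' u : triple) :
  below t t' -> u \in kids t -> exists2 u', u' \in kids t' & below u u'.
Proof.
case: t t' => [[X a] b] [[X' a'] b'] /and3P[/= /eqP <- ha hb].
case/kidsP=> [A B h hA ->|A B h hA ->|K s h ->].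
- exists (A, a', minn b' (len A)); last by rewrite /below /= eqxx; lia.
  by apply/kidsP; apply: KidLeft h _ _ => //; lia.
- exists (B, a' - len A, b' - len A); last by rewrite /below /= eqxx; lia.
  by apply/kidsP; apply: KidRight h _ _ => //; lia.
exists (K, s + a', s + b'); last by rewrite /below /= eqxx; lia.
by apply/kidsP; apply: KidCut h _.
Qed.

Lemma kid_occurs (t u : triple) : valid t -> u \in kids t ->
  exists2 k, k + (u.2 - u.1.2) <= t.2 - t.1.2 &
    factor (E u.1.1) u.1.2 u.2 =
    factor (E t.1.1) (t.1.2 + k) (t.1.2 + k + (u.2 - u.1.2)).
Proof.
case: t => [[X a] b]; rewrite /valid /= => /andP[ab bX] /kidsP[A B h ha ->|A B h hb ->|K s h ->] /=.
- exists 0; first lia.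
  by rewrite addn0 (split_factor_l _ h) ?subnKC //; lia.
(* The right kid starts at the boundary if that lies inside the node, and otherwise at offset 0;
   truncated subtraction gives both. *)
- exists (len A - a); first lia.
  rewrite (split_factor_r h); [|lia|lia].
  by congr (factor _ _ _); lia.
exists 0; first lia.
by rewrite (cut_factor _ h); [congr (factor _ _ _)|]; lia.
Qed.

(** * Reached and maximal demands *)

Let N := (\max_X len X).+1.
(** Since [N] exceeds the length of every expansion, all valid triples embed in this finite type,
    where maximal elements exist and sets can be counted. *)
Local Notation demand := (V * 'I_N * 'I_N)%type.

Definition nt (d : demand) : V := d.1.1.
Definition lo (d : demand) : nat := d.1.2.
Definition hi (d : demand) : nat := d.2.

Definition triple_of (d : demand) : triple := (nt d, lo d, hi d).

Lemma lo_lt (d : demand) : lo d < N.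
Proof. exact: ltn_ord. Qed.

Lemma triple_of_inj : injective triple_of.
Proof.
by move=> [[X a] b] [[Y c] d] []; rewrite /nt /lo /hi /= => -> /val_inj -> /val_inj ->.
Qed.

Lemma triple_of_valid (t : triple) : valid t -> exists d, triple_of d = t.
Proof.
case: t => [[X a] b] /andP[/= ab bX].
have hX : len X <= \max_Y len Y by apply: (leq_bigmax (F := fun Y => len Y)).
have bN : b < N by rewrite /N ltnS; lia.
have aN : a < N by lia.
by exists (X, Ordinal aN, Ordinal bN).
Qed.

Definition step (d e : demand) : bool := triple_of e \in kids (triple_of d).

Definition dle (d e : demand) : bool := below (triple_of d) (triple_of e).

Variable root : demand.
Hypothesis root_eq : triple_of root = (start C, 0, len (start C)).
Hypothesis T_nonempty : 0 < len (start C).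

Local Notation T := (E (start C)).

Definition reached : {set demand} := [set d | connect step root d].

Lemma root_reached : root \in reached.
Proof. by rewrite inE connect0. Qed.

Lemma step_reached (d e : demand) : d \in reached -> step d e -> e \in reached.
Proof. by rewrite !inE => hd he; apply: connect_trans hd (connect1 he). Qed.

Lemma reached_ind (P : demand -> Prop) : P root ->
  (forall d e, d \in reached -> P d -> step d e -> P e) ->
  forall d, d \in reached -> P d.
Proof.
move=> P0 PS d; rewrite inE => /connectP[p + ->]; elim/last_ind: p => [|p e IH] //.
rewrite rcons_path last_rcons => /andP[hp he]; apply: PS (IH hp) he.
by rewrite inE; apply/connectP; exists p.
Qed.

Lemma reached_valid (d : demand) : d \in reached -> valid (triple_of d).
Proof.
move: d; apply: reached_ind; first by rewrite root_eq /valid /= T_nonempty /=.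
by move=> d e _ hd; apply: kid_valid hd.
Qed.

Lemma reached_occurs (d : demand) : d \in reached ->
  exists o, o + (hi d - lo d) <= len (start C) /\
    factor T o (o + (hi d - lo d)) = factor (E (nt d)) (lo d) (hi d).
Proof.
move: d; apply: reached_ind.
  move: root_eq => -[-> -> ->]; exists 0; split; first lia.
  by rewrite subn0.
move=> d e hd [o [ho eo]] /(kid_occurs (reached_valid hd)) [k /= hk ek].
have /andP[/= v1 v2] := reached_valid hd.
exists (o + k); split; first lia.
rewrite ek -!addnA -(@factor_factor _ _ _ (o + (hi d - lo d))); last first.
  by rewrite addKn; exact: hk.
by rewrite eo factor_factor.
Qed.

Definition maximal : {set demand} :=
  [set d in reached | [forall e in reached, dle d e ==> (e == d)]].

Lemma maximal_reached (d : demand) : d \in maximal -> d \in reached.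
Proof. by rewrite inE => /andP[]. Qed.

Lemma maximalP (d e : demand) :
  d \in maximal -> e \in reached -> dle d e -> e = d.
Proof.
rewrite inE => /andP[_ /forall_inP h] he hle.
by apply/eqP; move: (h e he); rewrite hle.
Qed.

Lemma reached_below_maximal (d : demand) : d \in reached ->
  exists2 m, m \in maximal & dle d m.
Proof.
move=> hd.
(* The weight is the length of the interval, shifted by [N] so that the subtraction never
   truncates. *)
have [||x y|m [mR mmax] dm] := @exists_dominating_maximal _ reached dle
    (fun d => N + hi d - lo d) d _ _ _ hd.
- by move=> x; rewrite /dle /below eqxx !leqnn.
- move=> y x z /and3P[/eqP e1 a1 b1] /and3P[/eqP e2 a2 b2].
  move: e1 a1 b1 e2 a2 b2 => /= e1 a1 b1 e2 a2 b2.
  by rewrite /dle /below /= e1 e2 eqxx /=; lia.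
- move=> /and3P[/eqP /= e1 /= a1 /= b1] /= w; apply: triple_of_inj.
  rewrite /triple_of e1; have := lo_lt x; have := lo_lt y.
  move=> *; have -> : lo y = lo x by rewrite /=; lia.
  by have -> : hi y = hi x by rewrite /=; lia.
exists m => //; rewrite inE mR; apply/forall_inP => e he.
by apply/implyP => /(mmax _ he) ->.
Qed.

(** Enlarge a reached parent of [m] to a maximal [d]. By [kid_mono] some kid of [d] contains [m],
    and it equals [m] by maximality. *)
Lemma maximal_parent (m : demand) : m \in maximal -> m != root ->
  exists2 d, d \in maximal & step d m.
Proof.
move=> mM mr; have := maximal_reached mM; rewrite inE => /connectP[p].
elim/last_ind: p => [_ /= e|p e _]; first by rewrite e eqxx in mr.
rewrite rcons_path last_rcons => /andP[hp he] em.
have hd : last root p \in reached by rewrite inE; apply/connectP; exists p.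
have [d dM le_d] := reached_below_maximal hd; exists d => //.
have [u hu le_u] := kid_mono le_d he.
have [f ef] := triple_of_valid (kid_valid (reached_valid (maximal_reached dM)) hu).
have sf : step d f by rewrite /step ef.
have fR := step_reached (maximal_reached dM) sf.
by rewrite -(maximalP mM fR) // /dle ef em.
Qed.

(** * Counting the marked demands *)

Lemma maximal_eq (d e : demand) : d \in maximal -> e \in maximal ->
  nt d = nt e -> lo d = lo e -> d = e.
Proof.
move=> dM eM h1 h2.
have [le|/ltnW le] := leqP (hi d) (hi e); last first.
  by apply: (maximalP eM (maximal_reached dM)); rewrite /dle /below /= h1 eqxx; lia.
by apply/esym/(maximalP dM (maximal_reached eM)); rewrite /dle /below /= h1 eqxx; lia.
Qed.

(* These are the maximal demands that receive a position of the attractor. *)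
Definition marked (d : demand) : bool :=
  (d \in maximal) &&
  match shape_of (nt d) with
  | Leaf => true
  | Split A _ => lo d < len A < hi d
  | Cut _ _ => false
  end.

(** By [maximal_eq] there is at most one for each nonterminal; the other marked demands are the
    excess to be paid for. *)
Definition leading (d : demand) : bool :=
  marked d && [forall e, (marked e && (nt e == nt d)) ==> (lo d <= lo e)].

Definition left_cut (d : demand) : bool := (d \in maximal) && (0 < lo d).

Definition is_cut (X : V) : bool := if shape_of X is Cut _ _ then true else false.

Definition cut_prefix (d : demand) : bool :=
  [&& d \in maximal, is_cut (nt d) & lo d == 0].

Lemma left_cut_parent (d : demand) : left_cut d ->
  exists2 e, e \in maximal & step e d.
Proof.
case/andP=> dM d0; apply: maximal_parent => //.
by apply: contraTneq d0 => ->; move: root_eq => -[_ -> _].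
Qed.

(** If a split has a left kid, the boundary lies to the right of [lo p], and then a right kid starts
    at 0. So at most one kid is truncated on the left. *)
Lemma left_cut_kid_inj (p d e : demand) :
  left_cut d -> left_cut e -> step p d -> step p e -> d = e.
Proof.
move=> /andP[_ d0] /andP[_ e0]; rewrite /step => hd he; apply: triple_of_inj.
move: hd he => /kidsP[A B h a ed|A B h b ed|K s h ed] /kidsP[A' B' h' a' ee|A' B' h' b' ee|K' s' h' ee];
  rewrite h in h'; move: h' => // -[? ?]; subst; rewrite ?ed ?ee //.
- by move: ee => -[_ ee _]; lia.
by move: ed => -[_ ed _]; lia.
Qed.

(** If [d] is a left kid and [p] is marked but not leading, a marked [e] starts further left; its
    left kid reaches up to the boundary and strictly contains [d], against maximality. If [d] is a
    right kid, [p] starts after the boundary and is unmarked. A cut is never marked. *)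
Lemma left_cut_parent_range (p d : demand) :
  p \in maximal -> left_cut d -> step p d ->
  (left_cut p && ~~ (marked p && ~~ leading p)) || cut_prefix p.
Proof.
move=> pM /andP[dM d0]; rewrite /step => /kidsP[A B h a ed|A B h b ed|K s h ed].
- have ea : lo d = lo p by case: ed.
  rewrite /left_cut pM -ea d0 /=; apply/orP; left.
  apply/negP => /andP[mp /negP]; apply; rewrite /leading mp.
  apply/forallP => e; apply/implyP => /andP[me /eqP ep].
  rewrite leqNgt; apply/negP => lt_ep.
  have /andP[eM] := me; rewrite ep h => /andP[ea' eb].
  have hu : (A, lo e, minn (hi e) (len A)) \in kids (triple_of e).
    by apply/kidsP; apply: (@KidLeft _ _ _ _ A B); rewrite ?ep.
  have [f ef] := triple_of_valid (kid_valid (reached_valid (maximal_reached eM)) hu).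
  have fR : f \in reached.
    by apply: step_reached (maximal_reached eM) _; rewrite /step ef.
  have := maximalP dM fR; rewrite /dle ef ed /below /= eqxx => /(_ _) fd.
  have {fd} : f = d by apply: fd; lia.
  by move=> fd; move: ef; rewrite fd ed => -[]; lia.
- have [_ ea _] : triple_of d = (B, lo p - len A, hi p - len A) by [].
  rewrite /left_cut pM /marked h; apply/orP; left.
  by rewrite /= in ea; lia.
rewrite /left_cut /cut_prefix /marked /is_cut pM h /=.
by case: (lo p).
Qed.

(** The parent map injects [L] into [L] without the excess [Mk :\: Fst], joined with [Z]. As the
    excess lies in [L], it has at most [#|Z|] elements, and [Fst] and [Z] together fit into [V]. *)
Lemma card_marked : #|[set d | marked d]| <= #|V|.
Proof.
set Mk := [set d | marked d]; set Fst := [set d | leading d].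
set L := [set d | left_cut d]; set Z := [set d | cut_prefix d].
have sFM : Fst \subset Mk by apply/subsetP => d; rewrite !inE => /andP[].
have sML : Mk :\: Fst \subset L.
  apply/subsetP => d; rewrite !inE => /andP[nl md]; have /andP[dM _] := md.
  rewrite /left_cut dM lt0n; apply: contra nl => /eqP d0.
  by rewrite /leading md; apply/forallP => e; rewrite d0 leq0n implybT.
(* On [L] the default [d] is never taken, by [left_cut_parent]. *)
pose par d := odflt d [pick e in maximal | step e d].
have parP d : left_cut d -> par d \in maximal /\ step (par d) d.
  move=> /left_cut_parent[e eM se]; rewrite /par; case: pickP => [f /andP[]//|/(_ e)].
  by rewrite eM se.
have par_inj : {in L &, injective par}.
  move=> d e; rewrite !inE => dL eL epar.
  apply: (left_cut_kid_inj dL eL (proj2 (parP d dL))).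
  by rewrite epar; exact: proj2 (parP e eL).
have par_range : par @: L \subset (L :\: (Mk :\: Fst)) :|: Z.
  apply/subsetP => _ /imsetP[d + ->]; rewrite inE => dL.
  have [pM sp] := parP d dL.
  have := left_cut_parent_range pM dL sp; rewrite !inE.
  by case/orP=> [/andP[-> h]|->]; rewrite ?orbT // andbT andbC h.
have disj : Fst :&: Z = set0.
  apply/setP => d; rewrite !inE; apply/negP => /andP[/andP[/andP[_ h] _]].
  by case/and3P => _; rewrite /is_cut; move: h; case: shape_of.
(* A nonterminal with a cut rule occurs only in [Z], any other only in [Fst]; in both sets [lo] is
   the least possible, so [nt] determines the demand. *)
have cardFZ : #|Fst :|: Z| <= #|V|.
  rewrite -(@card_in_imset _ _ (fun d : demand => nt d)); first exact: max_card.
  have key d e : d \in Fst :|: Z -> e \in Fst :|: Z -> nt d = nt e ->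
      lo d <= lo e.
    rewrite !inE => /orP[/andP[md /forallP hd]|/and3P[_ _ /eqP -> //]].
    case/orP=> [/andP[me _]|/and3P[_ + _]] de.
      by have := hd e; rewrite me de eqxx.
    by move: md; rewrite /marked /is_cut de; case: shape_of => //; rewrite andbF.
  have inM d : d \in Fst :|: Z -> d \in maximal.
    by rewrite inE => /orP[]; rewrite inE; [case/andP=> /andP[]|case/and3P].
  move=> d e dF eF de; apply: (maximal_eq _ _ de); rewrite ?inM //.
  by apply/eqP; rewrite eqn_leq !key.
have := subset_leq_card par_range; rewrite card_in_imset // => h1.
have h2 := leq_trans h1 (leq_card_setU _ _).
have h3 := cardsD L (Mk :\: Fst); rewrite (setIidPr sML) in h3.
have h4 := subset_leq_card sML.
have h5 := cardsD Mk Fst; rewrite (setIidPr sFM) in h5.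
have h6 := subset_leq_card sFM.
have h7 := cardsU Fst Z; rewrite disj cards0 in h7.
lia.
Qed.

(** * Descent of a substring until it is covered *)

Definition demanded (t : triple) : Prop :=
  exists2 m, m \in maximal & below t (triple_of m).

Lemma demanded_kid (t u : triple) : demanded t -> u \in kids t -> demanded u.
Proof.
case=> m mM tm ut; have [u' u'm uu'] := kid_mono tm ut.
have [d ed] := triple_of_valid (kid_valid (reached_valid (maximal_reached mM)) u'm).
have dR : d \in reached by apply: step_reached (maximal_reached mM) _; rewrite /step ed.
have [m' m'M /and3P[/eqP]] := reached_below_maximal dR; rewrite ed => e1 a1 b1.
exists m' => //; have /and3P[/eqP e2 a2 b2] := uu'.
by rewrite /below e2 e1 eqxx /= (leq_trans a1 a2) (leq_trans b2 b1).
Qed.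

(** Counted from 0, this is the first character after the boundary. The value 0 also serves leaves,
    which have one character. *)
Definition split_point (X : V) : nat :=
  if shape_of X is Split A _ then len A else 0.

Section Coverage.

Variable G : pred nat.
Hypothesis G_marks : forall d, marked d -> exists o,
  [/\ o + (hi d - lo d) <= len (start C),
      factor T o (o + (hi d - lo d)) = factor (E (nt d)) (lo d) (hi d)
    & G (o + (split_point (nt d) - lo d))].

Definition covered (w : seq Sigma) : Prop :=
  exists o, [/\ o + size w <= len (start C), take (size w) (drop o T) = w
    & exists2 g, G g & o <= g < o + size w].

Lemma covered_marked (m : demand) (x y : nat) :
  marked m -> lo m <= x -> x <= split_point (nt m) < y -> y <= hi m ->
  covered (factor (E (nt m)) x y).
Proof.
move=> mm lx /andP[xp py] yh; have /andP[mM _] := mm.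
have /andP[/= v1 v2] := reached_valid (maximal_reached mM).
have [o [ho eo Go]] := G_marks mm.
have sz : size (factor (E (nt m)) x y) = y - x by rewrite size_factor //; lia.
exists (o + (x - lo m)); rewrite sz; split; first lia.
  have := congr1 (fun s => factor s (x - lo m) (y - lo m)) eo.
  rewrite !factor_factor; [|lia|lia].
  rewrite subnKC // subnKC; last lia.
  move=> <-; rewrite /factor; congr (take _ _); lia.
by exists (o + (split_point (nt m) - lo m)) => //; lia.
Qed.

Lemma covered_leaf (X : V) (x y : nat) :
  shape_of X = Leaf -> valid (X, x, y) -> demanded (X, x, y) ->
  covered (factor (E X) x y).
Proof.
move=> hX /andP[/= xy yX] [m mM /and3P[/= /eqP eX lx yh]].
have l1 := leaf_len hX; subst X.
by apply: covered_marked => //; rewrite ?/marked ?mM /split_point hX //; lia.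
Qed.

Lemma covered_split (X A B : V) (x y : nat) :
  shape_of X = Split A B -> x < len A < y -> demanded (X, x, y) ->
  covered (factor (E X) x y).
Proof.
move=> hX /andP[xA Ay] [m mM /and3P[/= /eqP eX lx yh]]; subst X.
by apply: covered_marked => //; rewrite ?/marked ?mM /split_point hX //; lia.
Qed.

Lemma demanded_left (X A B : V) (x y : nat) :
  shape_of X = Split A B -> x < y <= len A -> demanded (X, x, y) ->
  demanded (A, x, y).
Proof.
move=> hX /andP[xy yA] /demanded_kid; apply; apply/kidsP.
by apply: (KidLeft hX); [lia|rewrite (minn_idPl yA)].
Qed.

Lemma demanded_right (X A B : V) (x y : nat) :
  shape_of X = Split A B -> len A <= x < y -> demanded (X, x, y) ->
  demanded (B, x - len A, y - len A).
Proof.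
move=> hX /andP[Ax xy] /demanded_kid; apply; apply/kidsP.
by apply: (@KidRight _ _ _ _ A B) => //; lia.
Qed.

(** Each passage to the right kid drops one copy of [R]. After [i] passages the factor starts in the
    first copy, and it either crosses the end of that copy or lies inside it. All these passages
    make up a single edge of the derivation tree. *)
Lemma power_descend (X R : V) (k i x y : nat) :
  rule_of C X = Power R k -> i * len R <= x < i.+1 * len R ->
  x < y <= len X -> demanded (X, x, y) ->
  covered (factor (E X) x y) \/
  [/\ y <= i.+1 * len R, demanded (R, x - i * len R, y - i * len R)
    & factor (E R) (x - i * len R) (y - i * len R) = factor (E X) x y].
Proof.
move=> hX; have hS : shape_of X = Split R X by rewrite /shape_of hX.
elim: i x y => [|i IH] x y hx hy hd.
  have [yR|Ry] := leqP y (len R); last by left; apply: covered_split hS _ hd; lia.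
  right; rewrite mul0n mul1n !subn0; split => //.
    by apply: demanded_left hS _ hd; lia.
  by rewrite (split_factor_l _ hS).
have hd' : demanded (X, x - len R, y - len R).
  by apply: demanded_right hS _ hd; rewrite mulSn in hx; lia.
have ef : factor (E X) x y = factor (E X) (x - len R) (y - len R).
  by rewrite {1}(split_factor_r hS) //; rewrite mulSn in hx; lia.
have hx' : i * len R <= x - len R < i.+1 * len R by rewrite !mulSn in hx *; lia.
have hy' : x - len R < y - len R <= len X by rewrite mulSn in hx; lia.
rewrite ef; case: (IH _ _ hx' hy' hd') => [|[h1 h2 h3]]; [by left|right].
have eq z : z - i.+1 * len R = z - len R - i * len R by rewrite mulSn; lia.
by rewrite !eq; split => //; rewrite mulSn; lia.
Qed.

(** Containment suffices, so a shrinking factor can be followed inside the derivation tree of any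
    earlier nonterminal. The successor converts to positions counted from 1. *)
Definition covers (n : node V) (t : triple) : Prop :=
  node_nonterminal n = t.1.1 /\
  match n with Whole _ => True | Part _ l r => l <= t.1.2.+1 /\ t.2 <= r end.

Local Notation child := (child C (fun X => len X)).

(** The quantifier over [n] lets one descent extend the paths from all visited nonterminals at
    once. *)
Definition descends (t u : triple) : Prop :=
  forall n, covers n t -> exists2 v, child n v & covers v u.

Lemma demanded_descend (t : triple) : valid t -> demanded t ->
  covered (factor (E t.1.1) t.1.2 t.2) \/
  exists u, [/\ valid u, demanded u,
    factor (E u.1.1) u.1.2 u.2 = factor (E t.1.1) t.1.2 t.2 & descends t u].
Proof.
case: t => [[X x] y] vt dt; have /andP[/= xy yX] := vt.
case hX: (rule_of C X) => [a|A B|R k|K l r].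
- by left; apply: covered_leaf => //; rewrite /shape_of hX.
- have hS : shape_of X = Split A B by rewrite /shape_of hX.
  have szX := split_len hS.
  have [yA|Ay] := leqP y (len A).
    right; exists (A, x, y); split.
    + by rewrite /valid /= xy.
    + by apply: demanded_left hS _ dt; rewrite xy.
    + by rewrite /= (split_factor_l _ hS).
    move=> [Z [/= -> _]|Z l r [/= -> [lx yr]]].
      by exists (Whole A) => //; apply: child_pair_l hX.
    exists (Part A l (minn r (len A))); last by split => //=; lia.
    by apply: (child_part_pair_l _ hX); lia.
  have [xA|Ax] := ltnP x (len A).
    by left; apply: covered_split hS _ dt; lia.
  right; exists (B, x - len A, y - len A); split.
  + by rewrite /valid /=; lia.
  + by apply: demanded_right hS _ dt; lia.
  + by rewrite /= (split_factor_r hS).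
  move=> [Z [/= -> _]|Z l r [/= -> [lx yr]]].
    by exists (Whole B) => //; apply: child_pair_r hX.
  exists (Part B (maxn l (len A).+1 - len A) (r - len A)); last by split => //=; lia.
  by apply: (child_part_pair_r _ hX); lia.
- have lX : len X = k * len R.
    by move: (expE X); rewrite hX => ->; rewrite size_flatten_nseq.
  have R0 : 0 < len R by rewrite lt0n; apply/eqP => R0; rewrite R0 muln0 in lX; lia.
  (* The quotient is the index of the copy of [R] in which the factor starts. *)
  have hi : (x %/ len R) * len R <= x < (x %/ len R).+1 * len R.
    by rewrite leq_trunc_div ltn_ceil.
  have hy : x < y <= len X by lia.
  move: hi; set i := x %/ len R => hi.
  case: (power_descend hX hi hy dt) => [|[h1 h2 h3]]; [by left|right].
  exists (R, x - i * len R, y - i * len R); split => //.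
    by rewrite /valid /=; rewrite mulSn in h1; lia.
  move=> [Z [/= -> _]|Z l r [/= -> [lx yr]]].
    by exists (Whole R) => //; apply: child_power hX.
  exists (Part R (maxn l (i * len R).+1 - i * len R)
                 (minn r (i.+1 * len R) - i * len R)).
    apply: (child_part_power hX); [|lia|lia].
    by rewrite -(ltn_pmul2r R0); lia.
  by split => //=; lia.
have hS : shape_of X = Cut K l.-1 by rewrite /shape_of hX.
have l0 : 0 < l by move: (expE X); rewrite hX; case.
have szX := cut_len hS.
right; exists (K, l.-1 + x, l.-1 + y); split.
- by rewrite /valid /=; lia.
- by apply: (demanded_kid dt); apply/kidsP; apply: (KidCut hS).
- by rewrite /= (cut_factor _ hS).
move=> [Z [/= -> _]|Z l' r' [/= -> [lx yr]]].
  exists (Part K l r); first exact: child_trunc hX.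
  have := expE X; rewrite hX => -[_ lr rK eX]; split => //=.
  by move: yX; rewrite eX /substr size_take_min size_drop; lia.
exists (Part K (l + l' - 1) (l + r' - 1)); first exact: child_part_trunc hX.
by split => //=; lia.
Qed.

(* The nonterminals met while descending are pairwise distinct: by acyclicity
   the tree of a visited nonterminal does not contain it again. *)
Lemma demanded_covered_visited (k : nat) (vs : seq V) (t : triple) :
  valid t -> demanded t -> uniq vs -> #|V| < k + size vs ->
  (forall Z, Z \in vs ->
     exists2 n, clos_trans (node V) child (Whole Z) n & covers n t) ->
  covered (factor (E t.1.1) t.1.2 t.2).
Proof.
elim: k vs t => [|k IH] vs t vt dt uvs kvs hvs.
  by move: kvs; rewrite ltnNge -(card_uniqP uvs) max_card.
have [//|[u [vu du <- tu]]] := demanded_descend vt dt.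
apply: (IH (t.1.1 :: vs)) => //=; last 2 first.
- by rewrite addnS.
- move=> Z; rewrite inE => /orP[/eqP ->|/hvs[n Zn /tu[v nv vu']]].
    have [//|v Wv vu'] := tu (Whole t.1.1).
    by exists v => //; apply: t_step.
  by exists v => //; apply: t_trans Zn _; apply: t_step.
rewrite uvs andbT; apply/negP => /hvs[n Zn [en _]].
exact: acyC Zn en.
Qed.

Lemma substrings_covered (x y : nat) :
  x < y <= len (start C) -> covered (factor T x y).
Proof.
move=> hxy; apply: (@demanded_covered_visited #|V|.+1 [::] (start C, x, y)) => //.
  have [m mM rm] := reached_below_maximal root_reached; exists m => //.
  move: rm; rewrite /dle root_eq /below => /and3P[/= -> /= h1 h2]; lia.
by rewrite addn0.
Qed.

End Coverage.

(** * Assembling the attractor *)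

Lemma small_attractor :
  exists Gamma : {set 'I_(size T)}, string_attractor Gamma /\ #|Gamma| <= #|V|.
Proof.
have marks d : exists o, marked d ->
    [/\ o + (hi d - lo d) <= len (start C),
        factor T o (o + (hi d - lo d)) = factor (E (nt d)) (lo d) (hi d)
      & o + (split_point (nt d) - lo d) < len (start C)].
  have [md|nmd] := boolP (marked d); last by exists 0.
  have /andP[dM hm] := md; have dR := maximal_reached dM.
  have /andP[/= v1 v2] := reached_valid dR.
  have [o [ho eo]] := reached_occurs dR.
  exists o => _; split=> //; rewrite /split_point.
  by case: shape_of hm => //; lia.
have [occ occP] := fin_all_exists marks.
(* For marked [d] the position is in range by [occP], so the default of [insubd] does not matter. *)
pose mark d : 'I_(len (start C)) :=
  insubd (Ordinal T_nonempty) (occ d + (split_point (nt d) - lo d)).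
pose Gamma := [set mark d | d in [set d | marked d]].
exists Gamma; split; last first.
  by apply: leq_trans (leq_imset_card _ _) _; exact: card_marked.
pose G g := [exists p in Gamma, val p == g].
have G_marks d : marked d -> exists o,
    [/\ o + (hi d - lo d) <= len (start C),
        factor T o (o + (hi d - lo d)) = factor (E (nt d)) (lo d) (hi d)
      & G (o + (split_point (nt d) - lo d))].
  move=> md; have [h1 h2 h3] := occP d md; exists (occ d); split=> //.
  apply/exists_inP; exists (mark d); last by rewrite val_insubd h3.
  by apply/imsetP; exists d => //; rewrite inE.
move=> i j i1 ij jT.
have hij : i.-1 < j <= len (start C) by lia.
have := substrings_covered G_marks hij.
rewrite /covered size_factor // => -[o [ho eo [g /exists_inP[p pG /eqP eg] hg]]].
have sz : j - i.-1 = j.+1 - i by lia.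
exists o.+1, (o + (j.+1 - i)); rewrite sz in ho eo hg.
split; [by []|lia|lia| |by exists p => //; rewrite -eg /= in hg; lia].
rewrite /substr (_ : (o + (j.+1 - i)).+1 - o.+1 = j.+1 - i) /=; last lia.
by rewrite eo /factor sz.
Qed.

End Collage.

Theorem theorem3p5 (Sigma : Type) (V : finType) (C : rule_system Sigma V)
    (c : nat) (T : seq Sigma) :
  system_size C = c ->
  collage_system_generating C T ->
  exists Gamma : {set 'I_(size T)}, string_attractor Gamma /\ #|Gamma| <= c.
Proof.
move=> <- [E [wfC expE acyC eT]]; subst T; rewrite /system_size.
(* For empty [T] the root triple would not be valid; there the empty set is an attractor. *)
have [T0|T_nonempty] := posnP (size (E (start C))).
  by exists set0; split; [move=> i j; lia|rewrite cards0].
have [|root root_eq] := @triple_of_valid _ _ E (start C, 0, size (E (start C))).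
  by rewrite /valid /= T_nonempty /=.
by apply: (small_attractor wfC expE acyC root_eq).
Qed.
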